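(* If $G$ is any finite group which is not an elementary abelian $2$-group, then $|G|\le 8(|G|-c(G))$, with equality if and only if $G\cong D_8\times {C_2}^n$ for some non-negative integer $n$.
   Context: For a finite group $G$, $c(G)$ denotes the number of cyclic subgroups of $G$ (including the trivial one). $D_8$ is the dihedral group of order $8$, $C_2$ is the cyclic group of order $2$, and ${C_2}^n$ is the direct product of $n$ copies of $C_2$. The trivial group is regarded as an elementary abelian $2$-group. *)

(* Defs.v *)
From mathcomp Require Import all_boot all_order all_fingroup all_algebra all_solvable.

Set Implicit Arguments.
Unset Strict Implicit.
Unset Printing Implicit Defensive.

Local Open Scope group_scope.

Definition cyclic_subgroups (gT : finGroupType) (G : {group gT}) :
  {set {group gT}} := [set H in subgroups G | cyclic H].

Definition num_cyclic (gT : finGroupType) (G : {group gT}) : nat :=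
  #|cyclic_subgroups G|.

(* The direct product of n copies of the additive group Z/2Z, under the
   pointwise operation; for n = 0 it is the trivial group. *)
Definition C2_power (n : nat) : finGroupType :=
  {dffun forall _ : 'I_n, 'Z_2}.

(* Not needed to state the bound, but shows that the truncated subtraction
   #|G| - num_cyclic G is the usual one. *)
Lemma num_cyclic_le_card (gT : finGroupType) (G : {group gT}) :
  num_cyclic G <= #|G|.
Proof.
have sub : cyclic_subgroups G \subset [set <[x]>%G | x in G].
  apply/subsetP=> H; rewrite !inE => /andP[sHG /cyclicP[x defH]].
  apply/imsetP; exists x; last by apply/val_inj.
  by rewrite -cycle_subG -defH.
exact: leq_trans (subset_leq_card sub) (leq_imset_card _ _).
Qed.

(* Main.v *)
Require Import Defs.
From mathcomp Require Import all_boot all_order all_fingroup all_algebra all_solvable.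
From mathcomp Require Import zify.

Set Implicit Arguments.
Unset Strict Implicit.
Unset Printing Implicit Defensive.

Import GroupScope.

(** Let I be the set of solutions of x^2 = 1 in G.  Assigning to an element the
    cyclic subgroup that it generates hits a subgroup of order m exactly
    totient m times.  This number is 1 for m <= 2 and at least 2 otherwise, so
    2 c(G) <= |G| + |I|, with equality when every order divides 4
    [double_num_cyclic_le, double_num_cyclic_exponent4].

    The bound thus follows from Miller's theorem that |I| <= 3|G|/4 unless G is
    an elementary abelian 2-group [card_Ldiv2_le].  For x in I, the set
    I meets x I inside the centraliser of x, and the intersection has at
    least 2|I| - |G| elements; if |I| > 3|G|/4, this exceeds |G|/2, so all of I
    is central, and G is abelian and equal to I.

    Equality in the bound forces |I| = 3|G|/4.  The same count now shows that
    the centraliser of a non-central x in I has index 2 and is contained in I,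
    hence is elementary abelian.  Two non-commuting elements x and t of I have
    centralisers that meet in a subgroup D of index 4, which centralises both
    and contains [x, t] = (x t)^2.  The group generated by x and t is D_8, and
    D splits over <(x t)^2>; the complement E gives G = D_8 x E
    [card_Ldiv2_eq_dprod].  Conversely such a product has exponent dividing 4,
    and at least 3/4 of its elements square to 1 [dihedral8_dprod_Ldiv2], so
    all the inequalities above are equalities. *)

(** * Counting cyclic subgroups by their generators *)

Lemma totient_gt1 n : 2 < n -> 1 < totient n.
Proof.
case: n => [|[|[|m]]] // _.
rewrite totient_count_coprime big_nat_recr //= big_nat_recl //= big_nat_recl //=.
rewrite coprimen1 coprimeSn; lia.
Qed.

(** A cyclic group of order m has totient m generators, each of order m. *)
Lemma sum_over_cyclic (gT : finGroupType) (G : {group gT}) (F : nat -> nat) :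
  \sum_(x in G) F #[x] =
  \sum_(H in cyclic_subgroups G) (totient #|H| * F #|H|)%N.
Proof.
rewrite (partition_big (fun x => <[x]>%G) (mem (cyclic_subgroups G))) /=; last first.
  by move=> x Gx; rewrite !inE cycle_subG Gx cycle_cyclic.
apply: eq_bigr => H; rewrite !inE => /andP[sHG /cyclicP[a defH]].
have cHa : #|H| = #[a] by rewrite defH.
rewrite {1}cHa totient_gen -sum_nat_const; apply: eq_big => [x | x].
  have sHE : (<[x]>%G == H) = (<[a]> == <[x]>).
    by rewrite eq_sym -val_eqE /= defH.
  rewrite sHE inE /generator; apply: andb_idl => /eqP defx.
  by rewrite -cycle_subG -defx -defH.
by case/andP=> _ /eqP <-.
Qed.

(** In this form both sides of the comparison between c(G) and the number of
    solutions of x^2 = 1 become sums of a function of the order. *)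
Lemma card_plus_Ldiv2 (gT : finGroupType) (G : {group gT}) :
  (#|G| + #|'Ldiv_2(G)|)%N = \sum_(x in G) (1 + (#[x] %| 2))%N.
Proof.
rewrite big_split /= sum1_card; congr (_ + _)%N.
rewrite -sum1_card big_mkcond [RHS]big_mkcond /=.
by apply: eq_bigr => x _; rewrite !inE order_dvdn; case: (x \in G); case: (_ == 1).
Qed.

(** A cyclic subgroup of order m contributes totient m to the right-hand side,
    twice that if m <= 2.  This is at least 2: a group of order 1 or 2 has one
    generator, counted twice, and any other cyclic group has at least two. *)
Lemma double_num_cyclic_le (gT : finGroupType) (G : {group gT}) :
  2 * num_cyclic G <= #|G| + #|'Ldiv_2(G)|.
Proof.
rewrite card_plus_Ldiv2 (sum_over_cyclic G (fun n => 1 + (n %| 2))%N).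
rewrite mulnC /num_cyclic -sum_nat_const; apply: leq_sum => H _.
have := cardG_gt0 H; case: #|H| => [|[|[|m]]] // _.
by have := @totient_gt1 m.+3 isT; lia.
Qed.

(** For m = 1, 2, 4 the contribution of a cyclic subgroup is exactly 2. *)
Lemma double_num_cyclic_exponent4 (gT : finGroupType) (G : {group gT}) :
  exponent G %| 4 -> (2 * num_cyclic G)%N = (#|G| + #|'Ldiv_2(G)|)%N.
Proof.
move=> eG4; rewrite card_plus_Ldiv2 (sum_over_cyclic G (fun n => 1 + (n %| 2))%N).
rewrite mulnC /num_cyclic -sum_nat_const; apply: eq_bigr => H.
rewrite !inE => /andP[sHG /cyclicP[a defH]].
have : #|H| %| 4.
  by rewrite defH; apply: dvdn_trans eG4; apply: dvdn_exponent; rewrite -cycle_subG -defH.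
by have := cardG_gt0 H; case: #|H| => [|[|[|[|[|m]]]]] // _ /dvdn_leq; lia.
Qed.

(** * Groups in which at least three quarters of the elements square to 1 *)

Lemma sqrg1_invg (gT : finGroupType) (a : gT) : a ^+ 2 = 1 -> a^-1 = a.
Proof. by move=> a2; apply/eqP; rewrite eq_invg_mul; apply/eqP. Qed.

Lemma Ldiv2_commute (gT : finGroupType) (a b : gT) :
  a ^+ 2 = 1 -> b ^+ 2 = 1 -> (a * b) ^+ 2 = 1 -> commute a b.
Proof.
by move=> /sqrg1_invg a2 /sqrg1_invg b2 /sqrg1_invg; rewrite invMg a2 b2.
Qed.

(** If y and x^-1 y both square to 1, and so does x, then so does the product
    of x^-1 = x with y, which makes x and y commute. *)
Lemma Ldiv2_shift_sub_centraliser (gT : finGroupType) (G : {group gT}) (x : gT) :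
  x \in 'Ldiv_2(G) -> 'Ldiv_2(G) :&: x *: 'Ldiv_2(G) \subset 'C_G[x].
Proof.
case/LdivP=> Gx x2; apply/subsetP=> y /setIP[/LdivP[Gy y2]].
rewrite mem_lcoset => /LdivP[_ xy2]; rewrite inE Gy; apply/cent1P.
rewrite (sqrg1_invg x2) in xy2.
exact/commute_sym/Ldiv2_commute.
Qed.

(** Inclusion-exclusion for two translates of the same subset of G. *)
Lemma card_Ldiv2_shift (gT : finGroupType) (G : {group gT}) (x : gT) :
  x \in G -> 2 * #|'Ldiv_2(G)| <= #|G| + #|'Ldiv_2(G) :&: x *: 'Ldiv_2(G)|.
Proof.
move=> Gx.
have cxI : #|x *: 'Ldiv_2(G)| = #|'Ldiv_2(G)| := card_lcoset _ _.
have := cardsUI 'Ldiv_2(G) (x *: 'Ldiv_2(G)); rewrite cxI.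
suff /subset_leq_card : 'Ldiv_2(G) :|: x *: 'Ldiv_2(G) \subset G by lia.
rewrite subUset subsetIl; apply/subsetP=> y.
by rewrite mem_lcoset inE groupMl ?groupV // => /andP[].
Qed.

Lemma gt_half_subgroup_eq (gT : finGroupType) (G H : {group gT}) :
  H \subset G -> #|G| < 2 * #|H| -> H :=: G.
Proof.
move=> sHG; rewrite -(Lagrange sHG) mulnC ltn_pmul2r // => lt2.
by apply/eqP; rewrite eqEsubset sHG -indexg_eq1; move: (indexg_gt0 G H); lia.
Qed.

(** The hypotheses force the centre to exceed half of G, so G is abelian; the
    solutions of x^2 = 1 then form a subgroup, again of more than half of G. *)
Lemma Ldiv2_central_abelem (gT : finGroupType) (G : {group gT}) :
  #|G| < 2 * #|'Ldiv_2(G)| -> 'Ldiv_2(G) \subset 'Z(G) -> 2.-abelem G.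
Proof.
move=> ltGI sIZ; have defZ : 'Z(G) = G.
  apply: gt_half_subgroup_eq (center_sub G) _.
  by apply: leq_trans ltGI _; rewrite leq_mul2l subset_leq_card.
have abG : abelian G by rewrite /abelian -{1}defZ subsetIr.
have defI : 'Ldiv_2(G) = G.
  exact: (@gt_half_subgroup_eq _ G (Group (group_Ldiv 2 abG))) (subsetIl _ _) ltGI.
by apply: exponent2_abelem; apply/exponentP=> x; rewrite -defI !inE => /andP[_ /eqP].
Qed.

(** Miller's bound.  If more than 3/4 of the elements square to 1, then the
    solution set and its translate by one of its elements x meet in more than
    half of G; they meet inside the centraliser of x, so x is central. *)
Lemma card_Ldiv2_le (gT : finGroupType) (G : {group gT}) :
  ~~ 2.-abelem G -> 4 * #|'Ldiv_2(G)| <= 3 * #|G|.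
Proof.
rewrite leqNgt; apply: contra => ltGI; apply: Ldiv2_central_abelem; first lia.
suff sIZ (x : gT) : x \in 'Ldiv_2(G) -> x \in 'Z(G) by apply/subsetP.
move=> Ix; have Gx : x \in G by case/setIP: Ix.
have leGI := card_Ldiv2_shift Gx.
have leIC := subset_leq_card (Ldiv2_shift_sub_centraliser Ix).
have ltGC : #|G| < 2 * #|'C_G[x]| by lia.
have defC : 'C_G[x] = G := gt_half_subgroup_eq (subsetIl _ _) ltGC.
by rewrite inE Gx -sub_cent1 -{1}defC subsetIr.
Qed.

(** At density exactly 3/4, the intersection of the solution set with its
    translate has at least |G|/2 elements, while it lies in a proper subgroup.
    It is therefore the whole centraliser, which thus consists of solutions. *)
Lemma cent_noncentral_involution (gT : finGroupType) (G : {group gT}) (x : gT) :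
  (4 * #|'Ldiv_2(G)|)%N = (3 * #|G|)%N -> x \in 'Ldiv_2(G) -> x \notin 'Z(G) ->
  (2 * #|'C_G[x]|)%N = #|G| /\ 'C_G[x] \subset 'Ldiv_2(G).
Proof.
move=> eqI Ix nZx; have Gx : x \in G by case/setIP: Ix.
have leGI := card_Ldiv2_shift Gx; have sIC := Ldiv2_shift_sub_centraliser Ix.
have leIC := subset_leq_card sIC.
have leC : 2 * #|'C_G[x]| <= #|G|.
  rewrite leqNgt; apply: contra nZx => /(gt_half_subgroup_eq (subsetIl _ _)) defC.
  by rewrite inE Gx -sub_cent1 -{1}defC subsetIr.
split; first lia.
suff <- : 'Ldiv_2(G) :&: x *: 'Ldiv_2(G) = 'C_G[x] by apply: subsetIl.
by apply/eqP; rewrite eqEcard sIC; lia.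
Qed.

(** * The extremal groups *)

(** With u = x t, the group generated by x and t is the product of <u>, of
    order 4, and <t>, of order 2, which inverts u. *)
Lemma involution_pair_dihedral8 (gT : finGroupType) (x t : gT) :
    x ^+ 2 = 1 -> t ^+ 2 = 1 -> ~ commute x t -> (x * t) ^+ 4 = 1 ->
  let K := <<[set x; t]>>%G in
  [/\ #|K| = 8, K \isog [set: 'D_8] & 'Z(K) = <[(x * t) ^+ 2]>].
Proof.
move=> x2 t2 ncxt u4 K; set u := x * t.
have ox : #[x] = 2.
  apply: nt_prime_order => //; apply/eqP=> x1; case: ncxt.
  by rewrite x1; apply/commute_sym/commute1.
have ot : #[t] = 2.
  apply: nt_prime_order => //; apply/eqP=> t1; case: ncxt.
  by rewrite t1; apply: commute1.
have nxt : x != t by apply/eqP=> xt; case: ncxt; rewrite xt.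
have ou : #[u] = 4.
  apply: (@orderXprime _ 2 2) => //; apply: nt_prime_order => //.
    by rewrite -expgM.
  by apply/eqP=> u2; case: ncxt; apply: Ldiv2_commute.
(* If t were a power of u = x t, it would commute with u, hence with u t^-1 = x. *)
have ntu : t \notin <[u]>.
  apply/negP=> /cycleP[i def_t]; case: ncxt; apply/commute_sym.
  have: commute t u by rewrite def_t; apply/commute_sym/commuteX.
  rewrite /u => /commuteM/(_ (commuteV (commute_refl t))).
  by rewrite mulgK.
have defK : K :=: <[u]> <*> <[t]>.
  apply/eqP; rewrite eqEsubset gen_subG join_subG !cycle_subG subUset !sub1set.
  have ut : t \in <[u]> <*> <[t]> by rewrite mem_gen // inE cycle_id orbT.
  have uu : u \in <[u]> <*> <[t]> by rewrite mem_gen // inE cycle_id.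
  rewrite ut -[x](mulgK t) -/u groupM ?groupV //=.
  by rewrite groupM ?mem_gen ?set21 ?set22.
have nut : <[t]> \subset 'N(<[u]>).
  rewrite cycle_subG; apply/normP; rewrite -cycleJ; apply/eqP.
  have ut : u * t = x by rewrite /u -mulgA (t2 : t * t = 1) mulg1.
  have -> : u ^ t = u^-1 by rewrite conjgE ut invMg (sqrg1_invg x2).
  by rewrite cycleV.
have cK : #|K| = 8.
  rewrite defK norm_joinEr // TI_cardMg -?orderE ?ou ?ot //.
  by rewrite setIC prime_TIg -?orderE ?ot // cycle_subG.
have isoK : K \isog [set: 'D_(2 ^ 3)].
  by have := involutions_gen_dihedral ox ot nxt; rewrite -[<<_>>]/(gval K) cK.
have gK : extremal_generators K 2 3 (u, t).
  split=> //; first by rewrite defK mem_gen // inE cycle_id.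
  by rewrite inE ntu mem_gen // set22.
by have [_ _ _ _ [-> _ _ _ _]] :=
  dihedral2_structure (isT : 1 < 3) gK isoK.
Qed.

(** Here D plays the part of the centre of G.  The dihedral group K generated
    by x and t meets D only in its own centre <y>, with y = (x t)^2, so a
    complement E of <y> in D completes K to a direct product; it has order
    8 * |D| / 2 = |G|. *)
Lemma dihedral8_dprod_of_pair (gT : finGroupType) (G D : {group gT}) (x t : gT) :
    x \in G -> t \in G -> x ^+ 2 = 1 -> t ^+ 2 = 1 -> ~ commute x t ->
    D \subset 'C_G([set x; t]) -> 2.-abelem D -> (4 * #|D|)%N = #|G| ->
    (x * t) ^+ 2 \in D ->
  exists K E : {group gT}, [/\ K \x E = G, K \isog [set: 'D_8] & 2.-abelem E].
Proof.
move=> Gx Gt x2 t2 ncxt /subsetIP[sDG cDxt] abD cD Dy.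
set y := (x * t) ^+ 2 in Dy *.
have y2 : y ^+ 2 = 1 by case/and3P: abD => _ _ /exponentP; apply.
have u4 : (x * t) ^+ 4 = 1 by rewrite (expgM _ 2 2).
have [cK isoK ZK] := involution_pair_dihedral8 x2 t2 ncxt u4.
rewrite -/y in ZK.
set K := <<_>>%G in cK isoK ZK.
have sKG : K \subset G by rewrite gen_subG subUset !sub1set Gx.
have cDK : D \subset 'C(K) by rewrite cent_gen.
clearbody K.
have [E [sED _ defYE]] := p_abelem_split1 abD Dy.
have [_ _ _ tiyE] := dprodP defYE.
exists K, E; split=> //; last exact: abelemS abD.
have cEK := subset_trans sED cDK.
have tiKE : K :&: E = 1.
  by apply/trivgP; rewrite /= -tiyE -ZK subsetI subsetIr /center setIS.
have oy : #[y] = 2.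
  by apply: nt_prime_order => //; apply/eqP=> y1; case: ncxt; apply: Ldiv2_commute.
rewrite dprodE //; apply/eqP.
rewrite eqEcard mul_subG ?(subset_trans sED) //= TI_cardMg // cK.
by rewrite -cD -(dprod_card defYE) -orderE oy mulnA.
Qed.

(** Take a non-central solution x and a solution t that does not commute with
    x.  Their centralisers are distinct elementary abelian subgroups of index 2,
    so their intersection D has index 4, and G' is contained in D because both
    quotients have order 2.  In particular (x t)^2 = [x, t] lies in D. *)
Lemma card_Ldiv2_eq_dprod (gT : finGroupType) (G : {group gT}) :
    ~~ 2.-abelem G -> (4 * #|'Ldiv_2(G)|)%N = (3 * #|G|)%N ->
  exists K E : {group gT}, [/\ K \x E = G, K \isog [set: 'D_8] & 2.-abelem E].
Proof.
move=> nabG eqI; have G0 := cardG_gt0 G.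
have [x [Ix nZx]] : exists x : gT, x \in 'Ldiv_2(G) /\ x \notin 'Z(G).
  suff /subsetPn[x] : ~~ ('Ldiv_2(G) \subset 'Z(G)) by exists x.
  by apply: contra nabG; apply: Ldiv2_central_abelem; lia.
have [cCx sCx] := cent_noncentral_involution eqI Ix nZx.
have [t [It nCt]] : exists t : gT, t \in 'Ldiv_2(G) /\ t \notin 'C_G[x].
  suff /subsetPn[t] : ~~ ('Ldiv_2(G) \subset 'C_G[x]) by exists t.
  by apply/negP=> /subset_leq_card; lia.
have [[Gx x2] [Gt t2]] : (x \in G /\ x ^+ 2 = 1) /\ (t \in G /\ t ^+ 2 = 1).
  by move: Ix It; rewrite !inE => /andP[-> /eqP->] /andP[-> /eqP->].
have ncxt : ~ commute x t by move=> /cent1P cxt; rewrite inE Gt cent1C cxt in nCt.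
have nZt : t \notin 'Z(G).
  by apply/negP=> /centerP[_ /(_ x Gx)/commute_sym/ncxt].
have [cCt sCt] := cent_noncentral_involution eqI It nZt.
have [D defD] : exists D : {group gT}, D :=: 'C_G[x] :&: 'C_G[t].
  by exists ('C_G[x] :&: 'C_G[t])%G.
have sDC : D \subset 'C_G[x] by rewrite defD subsetIl.
have nDx : x \notin D.
  by rewrite defD; apply/negP=> /setIP[_ /setIP[_ /cent1P/ncxt]].
have cD2 : (2 * #|D|)%N = #|'C_G[x]|.
  apply/eqP; rewrite eqn_leq; apply/andP; split.
    rewrite leqNgt; apply/negP=> /(gt_half_subgroup_eq sDC) eqDC; case/negP: nDx.
    by rewrite eqDC inE Gx cent1id.
  have eqC : #|'C_G[t]| = #|'C_G[x]|.
    by apply/eqP; rewrite -(eqn_pmul2l (isT : 0 < 2)) cCt cCx.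
  (* The product formula: |C_G(x)| |C_G(t)| = |C_G(x) C_G(t)| |D| <= |G| |D|. *)
  rewrite -(@leq_pmul2l #|'C_G[x]|) ?cardG_gt0 // -{2}eqC mul_cardG -defD.
  rewrite mulnA [(_ * 2)%N]mulnC cCx leq_mul2r subset_leq_card ?orbT //.
  by rewrite mul_subG ?subsetIl.
have cD : (4 * #|D|)%N = #|G| by rewrite -cCx -cD2 mulnA.
have abD : 2.-abelem D.
  apply: exponent2_abelem; apply/exponentP=> a /(subsetP sDC)/(subsetP sCx).
  by rewrite !inE => /andP[_ /eqP].
have nC (a : gT) : (2 * #|'C_G[a]|)%N = #|G| -> ([~ x, t] \in 'C_G[a]).
  move=> cCa; have iCa : #|G : 'C_G[a]| = 2.
    by rewrite -divgS ?subsetIl // -cCa mulnK ?cardG_gt0.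
  have nCa := index2_normal (subsetIl _ _) iCa.
  suff /subsetP : G^`(1) \subset 'C_G[a] by apply; apply: mem_commg.
  apply: der1_min (normal_norm nCa) _; apply: cyclic_abelian.
  by rewrite prime_cyclic // card_quotient ?normal_norm // iCa.
apply: (dihedral8_dprod_of_pair Gx Gt x2 t2 ncxt _ abD cD); last first.
  suff -> : (x * t) ^+ 2 = [~ x, t] by rewrite defD inE !nC.
  by rewrite commgEl conjgE !sqrg1_invg // mulgA.
rewrite defD subsetI subIset ?subsetIl //= centsC subUset !sub1set.
by apply/andP; split; apply/centP=> d /setIP[/setIP[_ /cent1P ?] /setIP[_ /cent1P ?]].
Qed.

(** In D_8 every element outside the cyclic subgroup <u> of order 4 is an
    involution, so only u and u^-1 do not square to 1.  In G the elements that
    do not square to 1 are therefore confined to the two cosets u E and u^-1 E,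
    which make up a quarter of G. *)
Lemma dihedral8_dprod_Ldiv2 (gT : finGroupType) (G K E : {group gT}) :
    K \x E = G -> K \isog [set: 'D_8] -> 2.-abelem E ->
  exponent G %| 4 /\ 3 * #|G| <= 4 * #|'Ldiv_2(G)|.
Proof.
move=> defG isoK /and3P[_ _ /exponentP eE].
have [_ defKE cKE _] := dprodP defG.
have [[u v] gK _] := generators_2dihedral (isT : 1 < 3) isoK.
have [[_ oKu _] _ _ _ _] := dihedral2_structure (isT : 1 < 3) gK isoK.
have [cK Ku ou _] := gK.
have u4 : u ^+ 4 = 1 by apply/eqP; rewrite -order_dvdn ou.
have expKE k e n : k \in K -> e \in E -> (k * e) ^+ n = k ^+ n * e ^+ n.
  by move=> Kk Ee; apply/expgMn/commute_sym/(centsP cKE).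
have K2 k : k \in K -> k \notin <[u]> -> k ^+ 2 = 1.
  by move=> Kk nuk; rewrite -[2](oKu k) ?expg_order // in_setD nuk.
split.
  apply/exponentP=> _ /[!(=^~ defKE)] /mulsgP[k e Kk Ee ->].
  rewrite expKE // (expgM e 2 2) eE ?groupX // mulg1.
  have [uk | nuk] := boolP (k \in <[u]>); last by rewrite (expgM k 2 2) (K2 k) ?expg1n.
  by apply/eqP; rewrite -order_dvdn -[4](ou : _ = 4) order_dvdG.
have : G \subset 'Ldiv_2(G) :|: (u *: E :|: u^-1 *: E).
  apply/subsetP=> g Gg; have := Gg; rewrite -{1}defKE => /mulsgP[k e Kk Ee defg].
  rewrite in_setU; apply/orP; case: (boolP (g \in _)) => [|nIg]; [by left | right].
  have k2 : k ^+ 2 != 1.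
    apply: contra nIg => /eqP k2; apply/LdivP; split=> //.
    by rewrite defg expKE // k2 eE // mulg1.
  have uk : k \in <[u]> by apply: contraR k2 => /(K2 k Kk)->.
  have [i lti defk] := cyclePmin uk.
  rewrite in_setU !mem_lcoset defg defk invgK.
  (* u^0 and u^2 square to 1; this leaves u itself and u^3 = u^-1. *)
  case: i lti defk => [|[|[|[|i]]]]; rewrite ou // => _ defk.
  - by rewrite defk expg0 expg1n eqxx in k2.
  - by rewrite expg1 mulKg Ee.
  - by rewrite defk -(expgM u 2 2) u4 eqxx in k2.
  by rewrite (mulgA u) -expgS u4 mul1g Ee orbT.
move/subset_leq_card/leq_trans/(_ (leq_card_setU _ _)).
have := leq_card_setU (u *: E) (u^-1 *: E); rewrite !card_lcoset => -[leU _].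
have := dprod_card defG; rewrite cK; lia.
Qed.

(** * The external direct product of D_8 and C_2^n *)

Lemma C2_power_abelem n : 2.-abelem [set: C2_power n].
Proof.
apply: exponent2_abelem; apply/exponentP=> f _; apply/ffunP=> i.
by rewrite !ffunE; case: (f i) => -[|[|]] // lti; apply: val_inj.
Qed.

Lemma card_C2_power n : #|[set: C2_power n]| = (2 ^ n)%N.
Proof. by rewrite cardsT card_ffun !card_ord. Qed.

(** An internal decomposition replaces the external product, because a finite
    elementary abelian 2-group is determined up to isomorphism by its order. *)
Lemma isog_dihedral8_C2_power (gT : finGroupType) (G : {group gT}) :
  (exists n, G \isog [set: 'D_8 * C2_power n]) <->
  exists K E : {group gT}, [/\ K \x E = G, K \isog [set: 'D_8] & 2.-abelem E].
Proof.
have defX n := setX_dprod [set: 'D_8]%G [set: C2_power n]%G.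
have setXT n : setX [set: 'D_8] [set: C2_power n] = [set: 'D_8 * C2_power n].
  by apply/setP=> a; rewrite !inE.
split=> [[n] | [K [E [defG isoK abE]]]]; last first.
  have [n cE] := p_natP (abelem_pgroup abE).
  exists n; have := isog_dprod defG (defX n); rewrite /= setXT; apply.
    exact: isog_trans isoK (isog_setX1 _ _).
  apply: isog_trans (isog_set1X _ _).
  by rewrite (isog_abelem_card _ abE) C2_power_abelem card_C2_power cE /=.
rewrite isog_sym => /isogP[f injf im_f].
have := injm_dprod (subxx _) injf (etrans (defX n) (setXT n)).
rewrite im_f => defG.
exists (f @* setX [set: 'D_8] 1)%G, (f @* setX 1 [set: C2_power n])%G; split=> //.
  rewrite isog_sym; apply: isog_trans (isog_setX1 _ _) _.
  exact: sub_isog (subsetT _) injf.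
by rewrite injm_abelem ?subsetT // -(isog_abelem (isog_set1X _ _)) C2_power_abelem.
Qed.

Local Close Scope group_scope.

Theorem corollary3 (gT : finGroupType) (G : {group gT}) :
  ~~ (2.-abelem G)%g ->
  #|G| <= 8 * (#|G| - num_cyclic G) /\
  (#|G| = 8 * (#|G| - num_cyclic G) <->
   exists n : nat, (G \isog [set: 'D_8 * C2_power n])%g).
Proof.
move=> nabG; have leI := card_Ldiv2_le nabG; have le_c := double_num_cyclic_le G.
split; first lia.
rewrite isog_dihedral8_C2_power; split=> [eqG | [K [E [defG isoK abE]]]].
  by apply: card_Ldiv2_eq_dprod => //; lia.
have [eG4 geI] := dihedral8_dprod_Ldiv2 defG isoK abE.
have := double_num_cyclic_exponent4 eG4; lia.
Qed.
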